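(* Let $(X,T)$ be a minimal Cantor system. If $\alpha$ belongs to the image subgroup $I(X,T)$, then there exists a function $g\in C(X,\mathbb{Z})$ such that $\int g\,d\mu=\alpha$ for every measure $\mu\in\mathcal{M}(X,T)$.
   Context: A Cantor system $(X,T)$ is a homeomorphism $T$ of a Cantor space $X$; it is minimal if $X$ has no proper non-empty closed $T$-invariant subset. $\mathcal{M}(X,T)$ is the set of $T$-invariant Borel probability measures on $X$, $C(X,\mathbb{Z})$ the set of continuous functions $X\to\mathbb{Z}$, and $$I(X,T)=\bigcap_{\mu\in\mathcal{M}(X,T)}\Big\{\int f\,d\mu: f\in C(X,\mathbb{Z})\Big\}\subseteq\mathbb{R}.$$ *)

(* Defs.v *)
From HB Require Import structures.
From mathcomp Require Import all_boot all_order all_algebra.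
From mathcomp Require Import all_classical all_reals all_analysis.
Set Implicit Arguments.
Unset Strict Implicit.
Unset Printing Implicit Defensive.
Import Order.TTheory GRing.Theory Num.Theory.
Local Open Scope classical_set_scope.
Local Open Scope ring_scope.

Definition homeomorphism (X Y : topologicalType) (f : X -> Y) : Prop :=
  exists g : Y -> X, [/\ cancel f g, cancel g f, continuous f & continuous g].

Definition is_cantor_space (X : topologicalType) : Prop :=
  exists h : cantor_space -> X, homeomorphism h.

Definition cantor_system (X : topologicalType) (T : X -> X) : Prop :=
  is_cantor_space X /\ homeomorphism T.

(* Invariance of F is read as T(F) = F; for a homeomorphism of a compact space
   the condition T(F) `<=` F yields the same notion of minimality. *)
Definition minimal_cantor_system (X : topologicalType) (T : X -> X) : Prop :=
  cantor_system T /\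
  forall F : set X, closed F -> T @` F = F -> F = set0 \/ F = [set: X].

(* X with its Borel sigma-algebra.  The library's measurable types are pointed,
   which costs nothing since Cantor spaces are nonempty. *)
Definition borel (X : ptopologicalType) :
    measurableType (sigma_display (@open X)) :=
  Measurable.clone _ (g_sigma_algebraType (@open X)) _.

Definition invariant_measures (R : realType) (X : ptopologicalType)
    (T : X -> X) : set (probability (borel X) R) :=
  [set mu : probability (borel X) R |
    forall A : set (borel X), measurable A -> mu (T @^-1` A) = mu A].

Definition continuous_int (X : topologicalType) : set (X -> int) :=
  [set f | continuous (f : X -> discrete_topology int)].

(* The integral is the real-valued one: a continuous integer-valued function on
   a compact space is bounded, hence integrable for every probability. *)
Definition image_subgroup (R : realType) (X : ptopologicalType)
    (T : X -> X) : set R :=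
  \bigcap_(mu in @invariant_measures R X T)
    [set \int[mu]_x (f x)%:~R | f in @continuous_int X].

Arguments invariant_measures R {X} T.
Arguments image_subgroup R {X} T.

(* Main.v *)
Require Import Defs.
From HB Require Import structures.
From mathcomp Require Import all_boot all_order all_algebra.
From mathcomp Require Import all_classical all_reals all_analysis.
From mathcomp Require Import measurable_realfun lra.
Set Implicit Arguments.
Unset Strict Implicit.
Unset Printing Implicit Defensive.
Import Order.TTheory GRing.Theory Num.Theory.
Import numFieldNormedType.Exports.
Local Open Scope classical_set_scope.
Local Open Scope ring_scope.

(** A Cantor space carries only countably many continuous integer functions
    [g 0, g 1, ...]: by compactness each one depends on finitely many
    coordinates ([countable_continuous_int]).  For each [n], integration of
    [g n] is an affine function of the measure, so the set of invariant
    probabilities where [g n] has integral [alpha] is an affine slice.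
    By hypothesis these countably many slices cover all invariant
    probabilities.  One of them must be everything, as in the Baire category
    theorem: countably many proper slices leave out a point.

    The omitted point can be written down as a countable convex combination.
    If no [g n] had constant integral [alpha], there would be invariant
    probabilities [mu n] with [g n] of integral different from [alpha] under
    [mu n].  Any mixture [nu] of the [mu n] with weights [w n] of sum 1 is again
    an invariant probability ([countable_mixture]), and
    [\int[nu] g m - alpha] is the sum over [n] of
    [w n * (\int[mu n] g m - alpha)].  In the array
    [h m n := \int[mu n] g m - alpha] the rows are bounded, because continuous
    functions on a compact space are, and the diagonal does not vanish.  This
    is enough to choose the weights so that no row has weighted sum 0
    ([generic_weights]).  Then no continuous integer function has integral
    [alpha] under [nu], which contradicts [alpha] being in the image
    subgroup. *)

(** * Weights that separate countably many linear forms from zero *)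

(** The diagonal construction behind [generic_weights].  Step [n] settles row
    [n]: its n-th partial sum is made nonzero by the choice between two weights,
    which is possible because [h n n] is nonzero, and the bound [e n.+1] on all
    later weights is taken so small that they cannot cancel this sum.  The form
    [w n <= 2 * (e n - e n.+1)] of the upper bound makes the tails of the
    series of weights telescope: they are at most [2 * e n]. *)
Lemma greedy_weights (R : realFieldType) (h : nat -> nat -> R) (B : nat -> R) :
  (forall n, 0 <= B n) -> (forall n, h n n != 0) ->
  exists w e : nat -> R, forall n,
    [/\ 0 < e n, 0 < w n, w n <= 2 * (e n - e n.+1) &
        4 * (B n + 1) * e n.+1 <= `|series (fun k => w k * h n k) n.+1|].
Proof.
move=> B0 h0.
(* A state is the family of current partial sums of all rows, together with
   the bound on the next weight.  Since [h n n] is nonzero, the n-th partial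
   sum of row [n] vanishes for at most one of the weights [e] and [e / 2]. *)
pose pick n (S : (nat -> R) * R) :=
  if S.1 n + S.2 * h n n == 0 then S.2 / 2 else S.2.
pose next n (S : (nat -> R) * R) :=
  let P := fun m => S.1 m + pick n S * h m n in
  (P, Num.min (S.2 / 2) (`|P n| / (4 * (B n + 1)))).
pose fix st n : (nat -> R) * R :=
  if n is k.+1 then next k (st k) else (fun=> 0, 1).
pose w n := pick n (st n).
have stE m n : (st n).1 m = series (fun k => w k * h m k) n.
  elim: n => [|n IHn]; first by rewrite /series/= big_geq.
  by rewrite seriesSr /= IHn.
have st_neq0 n : 0 < (st n).2 -> (st n.+1).1 n != 0.
  move=> e0 /=; rewrite /pick; have [P0|//] := eqVneq ((st n).1 n + _) 0.
  apply: contraNneq (h0 n) => P0'.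
  have : (st n).2 / 2 * h n n = 0 by lra.
  by move/eqP; rewrite mulf_eq0 gt_eqF ?divr_gt0.
have B1 n : 0 < 4 * (B n + 1) by have := B0 n; lra.
have e0 n : 0 < (st n).2.
  elim: n => [|n IHn] /=; first exact: ltr01.
  by rewrite lt_min !divr_gt0//= normr_gt0; exact: st_neq0.
exists w, (fun n => (st n).2) => n; split => //.
- by rewrite /w /pick; case: ifP => _; rewrite ?divr_gt0.
- have : (st n.+1).2 <= (st n).2 / 2 by rewrite /= ge_min lexx.
  have := e0 n; rewrite /w /pick; case: ifP => _; lra.
- rewrite -stE mulrC -ler_pdivlMr//.
  by rewrite [leLHS]/= ge_min lexx orbT.
Qed.

(** A quantitative Baire argument in the space of summable weights: each row
    of [h] is a nonzero bounded linear form on it, so its kernel is a closed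
    hyperplane, and countably many hyperplanes do not cover the positive cone.
    The weighted sums converge absolutely, hence their not tending to 0 says
    that they are nonzero. *)
Lemma generic_weights (R : realType) (h : nat -> nat -> R) (B : nat -> R) :
  (forall m n, `|h m n| <= B m) -> (forall n, h n n != 0) ->
  exists w : nat -> R, [/\ forall n, 0 <= w n,
    series w @ \oo --> (1 : R) &
    forall m, ~ series (fun n => w n * h m n) @ \oo --> (0 : R)].
Proof.
move=> hB h0.
have B0 n : 0 <= B n by apply: le_trans (hB n n).
have [w [e we]] := greedy_weights B0 h0.
have e_gt0 n : 0 < e n by case: (we n).
have w_gt0 n : 0 < w n by case: (we n).
have w_le n : w n <= 2 * (e n - e n.+1) by case: (we n).
have w_cvg : cvgn (series w).
  apply: nondecreasing_is_cvgn.
    by apply/nondecreasing_seqP => n; rewrite seriesSr lerDl ltW.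
  exists (2 * e 0%N) => _ [n _ <-].
  apply: (@le_trans _ _ (2 * (e 0%N - e n))); last by have := e_gt0 n; lra.
  elim: n => [|n IHn]; first by rewrite /series/= big_geq// subrr mulr0.
  by rewrite seriesSr; have := w_le n; lra.
have tail m k : `|series (fun n => w n * h m n) (m.+1 + k)%N
                  - series (fun n => w n * h m n) m.+1|
                 <= B m * (2 * (e m.+1 - e (m.+1 + k)%N)).
  elim: k => [|k IHk]; first by rewrite addn0 !subrr normr0 !mulr0.
  rewrite addnS seriesSr -addrAC.
  apply: le_trans (ler_normD _ _) _.
  have: `|w (m.+1 + k)%N * h m (m.+1 + k)%N| <=
      B m * (2 * (e (m.+1 + k)%N - e (m.+1 + k).+1)).
    by rewrite normrM mulrC ler_pM// gtr0_norm.
  lra.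
(* Row [m] keeps a distance to 0 from index [m.+1] on, with room to spare:
   [4 * (B m + 1) - 2 * B m >= B m + 1]. *)
have away m k : (B m + 1) * e m.+1 <=
    `|series (fun n => w n * h m n) (m.+1 + k)%N|.
  have [_ _ _ big_m] := we m.
  have := tail m k; rewrite distrC => /(le_trans (lerB_dist _ _)).
  have : 0 <= B m * e (m.+1 + k)%N by rewrite mulr_ge0// ltW.
  have : 0 <= B m * e m.+1 by rewrite mulr_ge0// ltW.
  have := e_gt0 m.+1.
  lra.
(* The weights sum to some [c > 0]; dividing by [c] preserves the rest. *)
pose c := limn (series w).
have c_gt0 : 0 < c.
  apply: (@lt_le_trans _ _ (series w 1)).
    by rewrite /series/= big_nat1.
  apply: nondecreasing_cvgn_le => //.
  by apply/nondecreasing_seqP => n; rewrite seriesSr lerDl ltW.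
exists (fun n => c^-1 * w n); split => [n||m].
- by rewrite mulr_ge0// ?invr_ge0 ltW.
- rewrite (_ : series _ = (fun n => c^-1 * series w n)); last first.
    by apply/funext => n; rewrite /series/= mulr_sumr.
  rewrite -(@mulVf _ c) ?gt_eqF//.
  by apply: cvgMr.
- rewrite (_ : series _ = (fun n => c^-1 * series (fun n => w n * h m n) n)).
    2: by apply/funext => n; rewrite /series/= mulr_sumr;
          apply: eq_bigr => i _; rewrite mulrA.
  move=> /(@cvgMr _ _ _ _ _ c); rewrite mulr0.
  under eq_fun do rewrite mulrA divff ?gt_eqF// mul1r.
  move=> s0.
  have ns0 : `|series (fun n => w n * h m n) n| @[n --> \oo] --> (0 : R).
    by rewrite -(normr0 R); exact: cvg_norm.
  have : (B m + 1) * e m.+1 <= 0.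
    rewrite -(cvg_lim _ ns0)//; apply: limr_ge; first by apply/cvg_ex; exists 0.
    near=> n.
    rewrite -(@subnKC m.+1 n); last by near: n; exact: nbhs_infty_ge.
    exact: away.
  by rewrite leNgt mulr_gt0// ltr_wpDl.
Unshelve. all: by end_near. Qed.

(** * Countable mixtures of probability measures *)

Lemma cvg_series_mulrD (R : realType) (w a : nat -> R) (c l W : R) :
  series w @ \oo --> W -> series (fun n => w n * a n) @ \oo --> l ->
  series (fun n => w n * (a n + c)) @ \oo --> l + W * c.
Proof.
move=> wW al.
rewrite (_ : series _ = (fun n => series (fun n => w n * a n) n
                                  + series w n * c)); last first.
  apply/funext => n; rewrite /series/= mulr_suml -big_split/=.
  by apply: eq_bigr => i _; rewrite mulrDr.
by apply: cvgD => //; exact: cvgMl.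
Qed.

Lemma bounded_probability_integrable d (T : measurableType d) (R : realType)
    (mu : probability T R) (f : T -> R) (B : R) :
  measurable_fun setT f -> (forall x, `|f x| <= B) ->
  mu.-integrable setT (EFin \o f).
Proof.
move=> mf fB; apply: measurable_bounded_integrable => //.
  by rewrite -ge0_fin_numE ?fin_num_measure.
exists B; split; first exact: num_real.
by move=> C BC x _; apply: le_trans (fB x) (ltW BC).
Qed.

Lemma normr_Rintegral_le d (T : measurableType d) (R : realType)
    (mu : probability T R) (f : T -> R) (B : R) :
  measurable_fun setT f -> (forall x, `|f x| <= B) ->
  `|\int[mu]_x f x| <= B.
Proof.
move=> mf fB; have if_ := bounded_probability_integrable mu mf fB.
apply: (le_trans (le_normr_Rintegral _ if_)) => //.
rewrite -[leRHS]mulr1 -[X in _ * X](_ : fine (mu setT) = 1); last first.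
  by rewrite probability_setT.
rewrite -Rintegral_cst//; apply: le_Rintegral => //.
  apply: bounded_probability_integrable => [|x]; last first.
    by rewrite normr_id; exact: fB.
  exact: measurableT_comp mf.
exact: finite_measure_integrable_cst.
Qed.

Lemma eseries_EFin_sum (R : realType) (u : nat -> R) (l : R) :
  series u @ \oo --> l -> (\sum_(n <oo) (u n)%:E = l%:E)%E.
Proof.
move=> ul; apply/cvg_lim => //.
under eq_fun do rewrite sumEFin.
by apply: cvg_EFin; [near=> n|exact: ul].
Unshelve. all: by end_near. Qed.

Lemma nneseries_fin_cvg (R : realType) (u : nat -> R) (l : R) :
  (forall n, 0 <= u n) -> (\sum_(n <oo) (u n)%:E = l%:E)%E ->
  series u @ \oo --> l.
Proof.
move=> u0 ul.
have cu : cvgn (series u) by apply: nnseries_is_cvg => //; rewrite ul ltry.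
by have := eseries_EFin_sum cu; rewrite ul => -[->].
Qed.

Lemma countable_mixture d (T : measurableType d) (R : realType)
    (mu : nat -> probability T R) (w : nat -> R) :
  (forall n, 0 <= w n) -> series w @ \oo --> (1 : R) ->
  exists nu : probability T R,
    (forall A, nu A = \sum_(n <oo) ((w n)%:E * mu n A))%E /\
    forall (f : T -> R) (B : R), measurable_fun setT f ->
      (forall x, `|f x| <= B) ->
      series (fun n => w n * \int[mu n]_x f x) @ \oo --> \int[nu]_x f x.
Proof.
move=> w0 w1.
pose m n : {measure set T -> \bar R} := mscale (NngNum (w0 n)) (mu n).
pose nu0 : {measure set T -> \bar R} := mseries m 0.
have nuE A : nu0 A = (\sum_(n <oo) ((w n)%:E * mu n A))%E by [].
have nuT : nu0 setT = 1%E.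
  rewrite nuE.
  under eq_eseriesr do rewrite probability_setT mule1.
  exact: eseries_EFin_sum.
pose nu : probability T R := HB.pack_for (probability T R) (mseries m 0)
  (Measure_isProbability.Build _ _ _ nu0 nuT).
exists nu; split => // f B mf fB.
(* Integration against a series of measures commutes with the sum for
   nonnegative functions, hence the shift of [f] by its bound [B]. *)
have mfB : measurable_fun setT (fun x => f x + B) by exact: measurable_funD.
have fB0 x : 0 <= f x + B by have := fB x; rewrite ler_norml; lra.
have fBn (P : probability T R) :
    (\int[P]_x (f x + B)%:E = (\int[P]_x f x + B)%:E)%E.
  have if_ := bounded_probability_integrable P mf fB.
  have iB : P.-integrable setT (EFin \o cst B).
    exact: finite_measure_integrable_cst.
  rewrite integralD_EFin// integral_cst//= probability_setT mule1 EFinD.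
  by rewrite fineK//; exact: integrable_fin_num.
have fBE0 x : setT x -> (0 <= (f x + B)%:E)%E by move=> _; rewrite lee_fin.
have mfBE : measurable_fun setT (fun x => (f x + B)%:E) by exact/measurable_EFinP.
have mix : (\sum_(n <oo) (w n * (\int[mu n]_x f x + B))%:E =
            (\int[nu]_x f x + B)%:E)%E.
  rewrite -fBn [RHS]ge0_integral_measure_series//.
  apply: eq_eseriesr => n _; rewrite ge0_integral_mscale//.
  by rewrite fBn EFinM.
have w_ge0 n : 0 <= w n * (\int[mu n]_x f x + B).
  by rewrite mulr_ge0// -lee_fin -fBn integral_ge0// => x _; rewrite lee_fin.
have := cvg_series_mulrD (c := - B) w1 (nneseries_fin_cvg w_ge0 mix).
by under eq_fun do rewrite addrK; rewrite mul1r addrK.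
Qed.

(** * Continuous integer-valued functions *)

(** The cylinders around [x] form a basis of neighbourhoods: points that agree
    with [x] on longer and longer prefixes converge to [x] coordinatewise, and
    this is convergence in the product topology. *)
Lemma nbhs_cantor_cylinder (x : cantor_space) (U : set cantor_space) :
  nbhs x U ->
  exists n, forall y : cantor_space, (forall i, (i < n)%N -> x i = y i) -> U y.
Proof.
move=> nU; apply: contrapT => /forallNP noncyl.
have {noncyl} /choice[y yP] : forall n, exists y : cantor_space,
    (forall i, (i < n)%N -> x i = y i) /\ ~ U y.
  by move=> n; have /existsNP[y /not_implyP] := noncyl n; exists y.
have y_cvg : y @ \oo --> x.
  apply/(@pointwise_cvgP nat bool) => i.
  apply/discrete_cvg; exists i.+1 => // n /= i_lt_n.
  by rewrite (yP n).1.
have [n _ /(_ n (leqnn n))] := y_cvg _ nU.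
exact: (yP n).2.
Qed.

Lemma continuous_int_nbhs (X : topologicalType) (f : X -> int) (x : X) :
  continuous_int f -> \forall y \near x, f y = f x.
Proof. by move=> cf; have /discrete_cvg := cf x. Qed.

Lemma continuous_int_open (X : topologicalType) (f : X -> int) (A : set int) :
  continuous_int f -> open (f @^-1` A).
Proof.
move=> cf; rewrite openE => x Ax.
by apply: filterS (continuous_int_nbhs x cf) => y; rewrite /preimage/= => ->.
Qed.

Lemma continuous_int_measurable (R : realType) (X : ptopologicalType)
    (f : X -> int) :
  continuous_int f ->
  measurable_fun setT (fun x : borel X => (f x)%:~R : R).
Proof.
move=> cf _ A _; rewrite setTI; apply: sub_sigma_algebra.
exact: (continuous_int_open [set k : int | A k%:~R] cf).
Qed.

Lemma continuous_int_bounded (X : topologicalType) (f : X -> int) :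
  compact [set: X] -> continuous_int f ->
  exists B : nat, forall x, `|f x| <= B%:Z.
Proof.
move=> /compact_near_coveringP cX cf.
have [x _|B _ fB] := cX nat \oo (fun B x => `|f x| <= B%:Z) _.
  exists (f @^-1` [set f x], [set B | (absz (f x) <= B)%N]) => /=.
    split; last by exists (absz (f x)).
    exact: (continuous_int_nbhs x cf).
  by move=> [y B] /= [-> fxB]; rewrite -abszE lez_nat.
by exists B => x; exact: (fB B (leqnn B)).
Qed.

(** At each point [f] is constant on a cylinder, and compactness makes the length
    of the prefixes uniform.  Compactness is used in the form of [near_covering]
    at the filter of large [n]. *)
Lemma continuous_int_cantor_cylinder (f : cantor_space -> int) :
  continuous_int f -> exists n, forall x y : cantor_space,
    (forall i, (i < n)%N -> x i = y i) -> f x = f y.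
Proof.
move=> cf.
pose P n (x : cantor_space) := forall y : cantor_space,
  (forall i, (i < n)%N -> x i = y i) -> f x = f y.
have [x _|n _ fn] :=
    (compact_near_coveringP _).1 cantor_space_compact nat \oo P _.
  have [n fn] := nbhs_cantor_cylinder (continuous_int_nbhs x cf).
  have cyl : nbhs x [set y | forall i, (i < n)%N -> x i = y i].
    elim: n {fn} => [|n IHn]; first by apply: filterS filterT => y _ i.
    have xn : nbhs x [set y : cantor_space | y n = x n].
      exact: (@proj_continuous nat (fun=> bool) n x _ (discrete_set1 (x n))).
    apply: filterS2 IHn xn => y yP yn i; rewrite ltnS leq_eqVlt.
    by case/predU1P => [->//|/yP].
  exists ([set y | forall i, (i < n)%N -> x i = y i], [set k | (n <= k)%N]).
    by split => //; exists n.
  move=> [y k] /= [xy nk] z yz.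
  rewrite fn// fn// => i i_lt_n; rewrite xy// yz//.
  exact: leq_trans nk.
by exists n => x y; exact: (fn n (leqnn n)).
Qed.

Lemma is_cantor_space_compact (X : topologicalType) :
  is_cantor_space X -> compact [set: X].
Proof.
move=> [h [h' [_ h'K ch _]]].
rewrite (_ : [set: X] = h @` setT); last first.
  by apply/esym; rewrite -subTset => x _; exists (h' x).
apply: (continuous_compact _ cantor_space_compact).
exact: continuous_subspaceT.
Qed.

(** A function that depends on the first [n] coordinates is given by a finite
    table of integers, and there are countably many tables. *)
Lemma countable_continuous_int (X : topologicalType) : is_cantor_space X ->
  exists2 g : nat -> X -> int, (forall n, continuous_int (g n)) &
    forall f, continuous_int f -> exists n, f = g n.
Proof.
case=> h [h' [hK h'K ch _]].
(* [dec] reads off a value from a finite table indexed by the prefixes of a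
   fixed length; codes of no continuous function stand for 0. *)
pose table n := {ffun n.-tuple bool -> int}.
pose dec (p : {n & table n}) (x : X) : int :=
  tagged p [tuple h' x i | i < tag p].
pose g n : X -> int := if unpickle n is Some p then
    if `[< continuous_int (dec p) >] then dec p else cst 0 else cst 0.
have c0 : continuous_int (cst 0 : X -> int) by move=> x; exact: cvg_cst.
exists g => [n|f cf].
  by rewrite /g; case: unpickle => // p; case: asboolP.
have cfh : continuous_int (f \o h).
  by move=> x; apply: continuous_comp; [exact: ch|exact: cf].
have [n fn] := continuous_int_cantor_cylinder cfh.
pose p : {n & table n} := Tagged table
  [ffun t : n.-tuple bool => f (h (fun i => nth false t i))].
have decE : f = dec p.
  apply/funext => x; rewrite /dec /= ffunE -{1}(h'K x).
  apply: fn => i i_lt_n.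
  by rewrite -[i]/(val (Ordinal i_lt_n)) -tnth_nth tnth_mktuple.
exists (pickle p); rewrite /g pickleK -decE.
by case: asboolP.
Qed.

(** * Values of the image subgroup *)

Unset Implicit Arguments.

Theorem lemma12 (R : realType) (X : ptopologicalType) (T : X -> X)
    (hT : minimal_cantor_system T) (alpha : R)
    (halpha : image_subgroup R T alpha) :
  exists2 g : X -> int, continuous_int g &
    forall mu : probability (borel X) R, invariant_measures R T mu ->
      \int[mu]_x (g x)%:~R = alpha.
Proof.
have [[X_cantor _] _] := hT.
have X_compact := is_cantor_space_compact X_cantor.
have [g cg gP] := countable_continuous_int X_cantor.
apply: contrapT => noint.
have /choice[mu muP] : forall n, exists mu : probability (borel X) R,
    invariant_measures R T mu /\ \int[mu]_x (g n x)%:~R != alpha.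
  move=> n; apply: contrapT => /forallNP nomu; apply: noint.
  exists (g n) => // mu mu_inv; apply/eqP; apply: contraT => mu_neq.
  by case: (nomu mu).
have /choice[B gB] n : exists B : nat, forall x, `|(g n x)%:~R| <= B%:R :> R.
  have [B gB] := continuous_int_bounded X_compact (cg n).
  by exists B => x; rewrite -intr_norm -[B%:R]/(B%:Z%:~R) ler_int.
have mg n := continuous_int_measurable (R:=R) (cg n).
pose h m n : R := \int[mu n]_x (g m x)%:~R - alpha.
have hB m n : `|h m n| <= (B m)%:R + `|alpha|.
  apply: (le_trans (ler_normB _ _)); rewrite lerD2r.
  exact: (normr_Rintegral_le (mu n) (mg m) (gB m)).
have h0 n : h n n != 0 by rewrite subr_eq0; have [] := muP n.
have [w [w0 w1 wh]] := generic_weights hB h0.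
have [nu [nuE nuI]] := countable_mixture mu w0 w1.
have nu_inv : invariant_measures R T nu.
  move=> A mA; rewrite !nuE; apply: eq_eseriesr => n _; congr (_ * _)%E.
  exact: (muP n).1.
have [f cf f_alpha] := halpha nu nu_inv.
have [m fE] := gP f cf; apply: (wh m).
have := cvg_series_mulrD (c := - alpha) w1 (nuI _ _ (mg m) (gB m)).
by rewrite -fE f_alpha mul1r subrr fE.
Qed.
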